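(* Let $m,n,\ell$ be natural numbers. Suppose there are a geometric query which maps every polynomial $g\in\mathbb{Q}[u_1,\dots,u_m,x_1,\dots,x_n]$ (with parameters $u_1,\dots,u_m$ and variables $x_1,\dots,x_n$) to an $\ell$-tuple of polynomials $\omega_1,\dots,\omega_\ell\in\mathbb{Q}[u_1,\dots,u_m]$ (depending on $g$), and a polynomial $q\in\mathbb{Q}[t_1,\dots,t_\ell,y]$ which is independent of $g$, such that for every $g$ the identity $$\prod_{(\varepsilon_1,\dots,\varepsilon_n)\in\{0,1\}^n}\bigl(y-g(u_1,\dots,u_m,\varepsilon_1,\dots,\varepsilon_n)\bigr)=q\bigl(\omega_1(u_1,\dots,u_m),\dots,\omega_\ell(u_1,\dots,u_m),y\bigr)$$ holds in $\mathbb{Q}[u_1,\dots,u_m,y]$. Then $\ell\ge 2^n$.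
   Context: The left-hand side of the identity is the canonical elimination polynomial of the elimination problem $(\exists x_1)\cdots(\exists x_n)\bigl(\bigwedge_{i=1}^n x_i^2-x_i=0\ \wedge\ y=g(u_1,\dots,u_m,x_1,\dots,x_n)\bigr)$ with $n$ quantified variables. The polynomial $q$ represents a fixed division-free arithmetic circuit with input $y$ whose parameters are $t_1,\dots,t_\ell$. A query here is a map from polynomials $g$ to $\ell$-tuples $(\omega_1,\dots,\omega_\ell)$. It is called geometric if for every $g$ and any two parameter instances $\alpha=(\alpha_1,\dots,\alpha_m)$ and $\alpha'=(\alpha'_1,\dots,\alpha'_m)$ in $\mathbb{C}^m$ such that $g(\alpha,x_1,\dots,x_n)$ and $g(\alpha',x_1,\dots,x_n)$ are the same polynomial in $x_1,\dots,x_n$, one has $\omega_j(\alpha)=\omega_j(\alpha')$ for all $j=1,\dots,\ell$. *)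

(* Defs.v *)
From mathcomp Require Import all_boot all_order all_algebra.
From mathcomp Require Import mpoly complex reals.

Set Implicit Arguments.
Unset Strict Implicit.
Unset Printing Implicit Defensive.

Import GRing.Theory Num.Theory.
Local Open Scope ring_scope.

(* Polynomials in u_1, ..., u_m, x_1, ..., x_n live in {mpoly rat[m + n]}, the
   parameters u being the first m variables; in {mpoly rat[m.+1]} and
   {mpoly rat[l.+1]}, the variable y is the last one. *)

Definition query (m n l : nat) : Type :=
  {mpoly rat[m + n]} -> l.-tuple {mpoly rat[m]}.

(* g(alpha, x_1, ..., x_n), a polynomial in x_1, ..., x_n alone *)
Definition specialize (R : realType) (m n : nat)
    (g : {mpoly rat[m + n]}) (alpha : m.-tuple R[i]) : {mpoly R[i][n]} :=
  map_mpoly ratr g \mPo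
    [tuple of [tuple (tnth alpha i)%:MP | i < m] ++ [tuple 'X_i | i < n]].

Definition geometric (R : realType) (m n l : nat) (w : query m n l) : Prop :=
  forall (g : {mpoly rat[m + n]}) (alpha alpha' : m.-tuple R[i]),
    specialize g alpha = specialize g alpha' ->
    forall j : 'I_l, (map_mpoly ratr (tnth (w g) j)).@[tnth alpha]
                   = (map_mpoly ratr (tnth (w g) j)).@[tnth alpha'] :> R[i].

(* g(u_1, ..., u_m, eps_1, ..., eps_n), as an element of Q[u_1, ..., u_m, y] *)
Definition at_vertex (m n : nat) (g : {mpoly rat[m + n]})
    (eps : n.-tuple bool) : {mpoly rat[m.+1]} :=
  g \mPo [tuple of [tuple mwiden 'X_i | i < m]
                   ++ [tuple (tnth eps i)%:R | i < n]].

Definition elim_poly (m n : nat) (g : {mpoly rat[m + n]}) : {mpoly rat[m.+1]} :=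
  \prod_(eps : n.-tuple bool) ('X_ord_max - at_vertex g eps).

(* Main.v *)
(** The interpolation polynomial [g] of arbitrary rational values [v] on the
    cube [{0,1}^n] has [elim_poly g = \prod_eps (y - v eps)].  Evaluating at
    [u = 0], the elementary symmetric functions of the [2 ^ n] values are, up to
    sign, the coefficients in [y] of [q], taken at the point [tau] of [l]
    numbers [w g] at [0].  If [l < 2 ^ n] these [2 ^ n] polynomials in [l]
    variables satisfy an algebraic relation, which would then be a relation
    between the elementary symmetric polynomials, contradicting their algebraic
    independence. *)
Require Import Defs.
From mathcomp Require Import all_boot all_order all_algebra.
From mathcomp Require Import mpoly complex reals.

Import GRing.Theory Num.Theory.
Local Open Scope ring_scope.

Lemma lift_max_widen (n : nat) (i : 'I_n) : lift ord_max i = widen_ord (leqnSn n) i.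
Proof. by apply: ord_inj; rewrite lift_max. Qed.

Lemma meval_muni (R : comNzRingType) (n : nat) (p : {mpoly R[n.+1]})
    (v : 'I_n.+1 -> R) :
  p.@[v] = (map_poly (meval (fun i => v (widen_ord (leqnSn n) i))) (muni p)).[v ord_max].
Proof.
rewrite muniE mevalE rmorph_sum horner_sum; apply: eq_bigr => k _.
rewrite /= map_polyZ map_polyXn hornerZ hornerXn.
rewrite /= mevalZ mevalX big_ord_recr /= mulrA; congr (_ * _ * _).
by apply: eq_bigr => i _; rewrite mnmE.
Qed.

Lemma meval_mwiden (R : comNzRingType) (n : nat) (p : {mpoly R[n]})
    (v : 'I_n.+1 -> R) :
  (mwiden p).@[v] = p.@[fun i => v (widen_ord (leqnSn n) i)].
Proof.
rewrite [in LHS](mpolyE p) (raddf_sum (@mwiden n R)) raddf_sum [RHS]mevalE.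
apply: eq_bigr => k _ /=.
rewrite mwidenZ mwidenX mevalZ mevalX big_ord_recr /= mnmwiden_ordmax expr0 mulr1.
by congr (_ * _); apply: eq_bigr => i _; rewrite mnmwiden_widen.
Qed.

(** Each coefficient of [p] is read off from [muni p]: the exponent of the last variable selects the
    power of [y], the remaining exponents a monomial in its coefficient. *)
Lemma muni_eq0 (R : comNzRingType) (n : nat) (p : {mpoly R[n.+1]}) :
  muni p = 0 -> p = 0.
Proof.
move=> p0; apply/mpolyP => k; rewrite mcoeff0.
have := congr1 (fun P : {poly {mpoly R[n]}} =>
  P`_(k ord_max)@_[multinom k (widen_ord (leqnSn n) i) | i < n]) p0.
rewrite coef0 mcoeff0 muniE coef_sum raddf_sum /= => <-.
rewrite {1}(mpolyE p) raddf_sum /=; apply: eq_bigr => k' _.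
rewrite coefZ coefXn mulr_natr raddfMn /= !mcoeffZ !mcoeffX.
rewrite -mulrnAr -mulrnA mulnb; congr (_ * (_ : bool)%:R).
apply/eqP/andP => [->|[/eqP e1 /eqP e2]]; first by split.
apply/mnmP => i; case: (unliftP ord_max i) => [j|] -> //.
have := congr1 (fun x : 'X_{1..n} => x j) e1; rewrite !mnmE.
by rewrite lift_max_widen.
Qed.

(** A nonzero [p] would have [size p] roots 0, 1, 2, ..., distinct in characteristic zero. *)
Lemma polyfun_eq0 (R : numDomainType) (p : {poly R}) : (forall x, p.[x] = 0) -> p = 0.
Proof.
move=> p0; apply/eqP; apply/negP => /negP nz.
have := max_poly_roots nz (rs := [seq i%:R | i <- iota 0 (size p)]).
rewrite size_map size_iota ltnn => h; suff: false by []; apply: h.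
  by apply/allP => x _; apply/rootP.
by rewrite map_inj_uniq ?iota_uniq //; apply: mulrIn; rewrite oner_neq0.
Qed.

Lemma mpolyfun_eq0 (R : numDomainType) (n : nat) (p : {mpoly R[n]}) :
  (forall v, p.@[v] = 0) -> p = 0.
Proof.
elim: n p => [|n IHn] p p0.
  have := p0 (fun _ => 0); rewrite (nvar0_mpolyC p) mevalC => ->; exact: mpolyC0.
apply/muni_eq0/polyP => k; rewrite coef0; apply: IHn => v.
rewrite -coef_map (_ : map_poly _ _ = 0) ?coef0 //; apply: polyfun_eq0 => y.
rewrite -{}(p0 (fun i => oapp v y (unlift ord_max i))) meval_muni unlift_none /=.
congr (_.[y]); apply/eq_map_poly => r; apply: meval_eq => i.
by rewrite -lift_max_widen liftK.
Qed.

Lemma tnth_rcons_max (T : Type) (l : nat) (t : l.-tuple T) (x : T) :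
  tnth [tuple of rcons t x] ord_max = x.
Proof. by rewrite (tnth_nth x) /= nth_rcons size_tuple ltnn eqxx. Qed.

Lemma tnth_rcons_widen (T : Type) (l : nat) (t : l.-tuple T) (x : T) (i : 'I_l) :
  tnth [tuple of rcons t x] (widen_ord (leqnSn l) i) = tnth t i.
Proof. by rewrite !(tnth_nth x) /= nth_rcons size_tuple ltn_ord. Qed.

Lemma card_bmultinom_le (l b : nat) : (#|{: 'X_{1..l < b}}| <= b ^ l)%N.
Proof.
case: b => [|b].
  rewrite (_ : #|_| = 0%N) //; apply/eqP; rewrite -leqn0 leqNgt.
  by apply/card_gt0P => -[k _]; have := bmdeg k.
rewrite -[X in (_ <= X ^ _)%N](card_ord b.+1) -[X in (_ <= _ ^ X)%N](card_ord l).
rewrite -card_ffun.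
pose f (k : 'X_{1..l < b.+1}) := [ffun i : 'I_l => inord (k i) : 'I_b.+1].
apply: (@leq_card _ _ f) => k1 k2 /ffunP e; apply/val_inj/mnmP => i.
have lt (k : 'X_{1..l < b.+1}) : (k i < b.+1)%N.
  apply: leq_ltn_trans (bmdeg k); rewrite mdegE (bigD1 i) //=; exact: leq_addr.
by have /(congr1 (@nat_of_ord _)) := e i; rewrite !ffunE !inordK.
Qed.

(** As [msize] is the degree plus one, successor bounds make degrees add up, and they also cover the
    zero polynomial, of [msize] 0. *)
Lemma leq_msizeM (R : idomainType) (l : nat) (p q : {mpoly R[l]}) (a b : nat) :
  (msize p <= a.+1)%N -> (msize q <= b.+1)%N -> (msize (p * q) <= (a + b).+1)%N.
Proof.
have [->|p0] := eqVneq p 0; first by rewrite mul0r msize0.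
have [->|q0] := eqVneq q 0; first by rewrite mulr0 msize0.
move=> pa qb; rewrite msizeM //; have := leq_add pa qb.
by rewrite addSn addnS; case: (_ + _)%N.
Qed.

Lemma leq_msize_prodX (R : idomainType) (l : nat) (I : finType)
    (f : I -> {mpoly R[l]}) (a : I -> nat) (c D : nat) :
  (forall i, msize (f i) <= c.+1)%N -> (forall i, a i <= D)%N ->
  (msize (\prod_i f i ^+ a i)%R <= (#|I| * (D * c)).+1)%N.
Proof.
move=> fc aD; rewrite -sum_nat_const.
elim/big_rec2: _ => [|i s p _ IH]; first by rewrite msize1.
apply: leq_msizeM IH; apply: (@leq_trans (a i * c).+1); last first.
  by rewrite ltnS leq_mul2r aD orbT.
elim: (a i) => [|k IHk]; first by rewrite expr0 msize1.
by rewrite exprS mulSn leq_msizeM.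
Qed.

(* There are [D.+1 ^ N] power products of the [f i] with exponents at most [D],
   and they lie in a space of dimension at most [B ^ l] with [B] linear in [D];
   so they are linearly dependent for [D] large. *)
Lemma mpoly_alg_dep (F : fieldType) (N l : nat) (f : N.-tuple {mpoly F[l]}) :
  (l < N)%N -> exists2 P : {mpoly F[N]}, P != 0 & P \mPo f = 0.
Proof.
move=> ltlN.
pose c := (\max_(i < N) msize (tnth f i))%N.
pose K := (N * c).+1.
(* Chosen so that [B <= K * D.+1] yields [B ^ l <= D * D.+1 ^ l < D.+1 ^ l.+1]. *)
pose D := (K ^ l)%N.
pose B := (N * (D * c)).+1.
pose A := {ffun 'I_N -> 'I_D.+1}.
have ltBA : (#|{: 'X_{1..l < B}}| < #|{: A}|)%N.
  apply: leq_ltn_trans (card_bmultinom_le _ _) _.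
  rewrite card_ffun !card_ord; apply: (@leq_trans (D.+1 ^ l.+1)); last first.
    by rewrite leq_exp2l // ltnS expn_gt0.
  have leB : (B <= K * D.+1)%N.
    rewrite /B /K mulSn addSn ltnS (leq_trans _ (leq_addl _ _)) //.
    by rewrite mulnCA mulnC leq_mul2l leqnSn orbT.
  apply: (@leq_ltn_trans ((K * D.+1) ^ l)).
    by case: (posnP l) => [->|l_gt0]; rewrite ?expn0 ?leq_exp2r.
  by rewrite expnMn expnS ltn_pmul2r ?expn_gt0 // ltnS.
have fc i : (msize (tnth f i) <= c.+1)%N by apply/leqW/(leq_bigmax i).
have aD (a : A) i : (a i <= D)%N by rewrite -ltnS ltn_ord.
pose Fa (a : A) := \prod_i tnth f i ^+ a i.
have szFa a : (msize (Fa a) <= B)%N.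
  by have := leq_msize_prodX _ _ _ _ _ _ _ fc (aD a); rewrite card_ord.
(* Row [i] lists the coefficients of one power product. With more rows than columns, the left kernel
   contains some [v != 0], whose entries become the coefficients of [P]. *)
pose M := \matrix_(i < #|{: A}|, j < #|{: 'X_{1..l < B}}|)
  (Fa (enum_val i))@_(bmnm (enum_val j)).
have : kermx M != 0.
  rewrite kermx_eq0 /row_free; apply: contraL ltBA => /eqP <-.
  by rewrite -leqNgt rank_leq_col.
case/rowV0Pn => v /sub_kermxP vM0 /rV0Pn[i0 vi0].
pose mon (a : A) := [multinom (a i : nat) | i < N].
have mon_inj : injective mon.
  move=> a b /mnmP e; apply/ffunP => i; apply: ord_inj.
  by have := e i; rewrite !mnmE.
exists (\sum_i v 0 i *: 'X_[mon (enum_val i)]).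
  apply: contraNneq vi0 => /(congr1 (mcoeff (mon (enum_val i0)))).
  rewrite mcoeff0 raddf_sum (bigD1 i0) //= big1 => [|i ne_i]; last first.
    rewrite mcoeffZ mcoeffX (inj_eq mon_inj) (inj_eq enum_val_inj).
    by rewrite (negPf ne_i) mulr0.
  by rewrite mcoeffZ mcoeffX eqxx mulr1 addr0 => ->.
have -> : (\sum_i v 0 i *: 'X_[mon (enum_val i)]) \mPo f
    = \sum_i v 0 i *: Fa (enum_val i).
  rewrite raddf_sum; apply: eq_bigr => i _.
  rewrite /= comp_mpolyZ comp_mpolyX /Fa; congr (_ *: _).
  rewrite (eq_bigr (fun j => tnth f j ^+ enum_val i j)) // => j _.
  by rewrite mnmE.
apply/mpolyP => k; rewrite mcoeff0 raddf_sum.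
(* Below degree [B] the coefficient is an entry of [v *m M]; from [B] on, no power product has
   any. *)
have [ltkB|leBk] := ltnP (mdeg k) B.
  have := congr1 (fun x : 'rV_ _ => x 0 (enum_rank (BMultinom ltkB))) vM0.
  rewrite !mxE => vM0k; rewrite -[RHS]vM0k; apply: eq_bigr => i _.
  by rewrite /= mcoeffZ mxE enum_rankK.
rewrite big1 // => i _; rewrite /= mcoeffZ memN_msupp_eq0 ?mulr0 //.
exact/msize_mdeg_ge/(leq_trans (szFa _)).
Qed.

(** Multilinear Lagrange interpolation, constant in the parameters: each product is the indicator of
    the vertex [e] on the cube. *)
Definition vertex_interpolation (m n : nat) (v : n.-tuple bool -> rat) :
    {mpoly rat[m + n]} :=
  \sum_e v e *: \prod_(i < n)
    (if tnth e i then 'X_(rshift m i) else 1 - 'X_(rshift m i)).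

Lemma at_vertex_interpolation (m n : nat) (v : n.-tuple bool -> rat)
    (eps : n.-tuple bool) :
  at_vertex (vertex_interpolation m n v) eps = (v eps)%:MP.
Proof.
rewrite /at_vertex; set T := [tuple of _].
have XT i : 'X_(rshift m i) \mPo T = (tnth eps i)%:R.
  by rewrite comp_mpolyXU -tnth_nth tnth_rshift tnth_mktuple.
have factorT (e : n.-tuple bool) i :
    (if tnth e i then 'X_(rshift m i) else 1 - 'X_(rshift m i)) \mPo T
    = (tnth e i == tnth eps i)%:R.
  case: (tnth e i); rewrite ?comp_mpolyB ?comp_mpoly1 XT; case: (tnth eps i) => //=.
    by rewrite subrr.
  by rewrite subr0.
rewrite raddf_sum (bigD1 eps) //= [X in _ + X]big1 ?addr0 => [|e ne_e].
  rewrite comp_mpolyZ (rmorph_prod (comp_mpoly T)) big1 => [|i _]; last first.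
    by rewrite /= factorT eqxx.
  by rewrite -mul_mpolyC mulr1.
have /existsP[i ne_i] : [exists i, tnth e i != tnth eps i].
  apply: contraR ne_e => /existsPn e_eps; apply/eqP/eq_from_tnth => i.
  by apply/eqP; rewrite -[_ == _]negbK e_eps.
rewrite comp_mpolyZ (rmorph_prod (comp_mpoly T)) (bigD1 i) //= factorT.
by rewrite (negPf ne_i) mul0r scaler0.
Qed.

Theorem mainTheorem2 (R : realType) (m n l : nat)
    (w : query m n l) (q : {mpoly rat[l.+1]})
    (w_geometric : geometric R w)
    (w_q_elim : forall g : {mpoly rat[m + n]},
       elim_poly g
       = q \mPo [tuple of rcons [tuple mwiden (tnth (w g) j) | j < l]
                                'X_ord_max]) :
  (2 ^ n <= l)%N.
Proof.
have <- : #|{: n.-tuple bool}| = (2 ^ n)%N by rewrite card_tuple card_bool.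
set N := #|_|; rewrite leqNgt; apply/negP => ltlN.
(* By Vieta, these are the coefficients that become the elementary symmetric functions of the roots.
   They depend on [q] alone, so [P] is fixed before the values [v] are chosen. *)
pose f := [tuple (-1) ^+ i.+1 *: (muni q)`_(N - i.+1) | i < N].
have [P nzP Pf0] := mpoly_alg_dep _ _ _ f ltlN.
case/eqP: nzP; apply/msym_fundamental_un0/mpolyfun_eq0 => v.
pose g := vertex_interpolation m n (fun e => v (enum_rank e)).
pose tau j := (tnth (w g) j).@[fun _ => 0].
have muniq : map_poly (meval tau) (muni q)
    = \prod_(c <- [tuple v i | i < N]) ('X - c%:P).
  apply/eqP; rewrite -subr_eq0; apply/eqP/polyfun_eq0 => y; apply/eqP.
  rewrite hornerD hornerN subr_eq0; apply/eqP.
  (* The point with all parameters 0 and last coordinate [y]. *)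
  pose z (i : 'I_m.+1) := if i == ord_max then y else 0.
  have zmax : z ord_max = y by rewrite /z eqxx.
  have z_widen i : z (widen_ord (leqnSn m) i) = 0.
    by rewrite /z -lift_max_widen eq_sym (negPf (neq_lift _ _)).
  transitivity (elim_poly g).@[z].
    rewrite w_q_elim comp_mpoly_meval meval_muni; congr (_.[_]); last first.
      by rewrite tnth_rcons_max mevalXU.
    apply/eq_map_poly => r; apply: meval_eq => j.
    by rewrite tnth_rcons_widen tnth_mktuple meval_mwiden; apply: meval_eq.
  rewrite rmorph_prod horner_prod big_tuple (reindex _ (onW_bij _ (@enum_rank_bij _))).
  apply: eq_bigr => eps _.
  rewrite /= mevalB mevalXU zmax at_vertex_interpolation mevalC.
  by rewrite tnth_mktuple hornerXsubC.
rewrite comp_mpoly_meval; transitivity (P \mPo f).@[tau]; last by rewrite Pf0 meval0.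
rewrite comp_mpoly_meval; apply: meval_eq => i; rewrite !tnth_mktuple mevalZ.
(* [lift ord0 i] has value [i.+1], skipping the leading coefficient. *)
have := mroots_coeff [tuple v i | i < N] (lift ord0 i).
rewrite -muniq coef_map lift0 /= => ->; rewrite signrMK.
by apply: meval_eq => j; rewrite tnth_mktuple.
Qed.
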